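(* A connected finite undirected simple graph $G=(V,E)$ contains a $\mathrm{PHC}_4$ if and only if $|V|$ is even or $G$ is non-bipartite.
   Context: A closed walk is a sequence $v_0e_1v_1\cdots e_\ell v_\ell$ with $e_i=\{v_{i-1},v_i\}\in E$ and $v_\ell=v_0$; vertices and edges may be repeated. The visit number of a vertex $v$ is the number of indices $i\in\{1,\dots,\ell\}$ with $v_i=v$. A parity Hamiltonian cycle (PHC) is a closed walk in which every vertex has odd visit number. For a positive integer $z$, a $\mathrm{PHC}_z$ is a PHC in which each edge of $G$ occurs at most $z$ times. *)

(* Defs.v *)
From mathcomp Require Import all_boot.

Set Implicit Arguments.
Unset Strict Implicit.
Unset Printing Implicit Defensive.

(* A simple graph is a symmetric irreflexive relation e on a finite type T of
   vertices; its edges are the sets [set x; y] with e x y. *)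

Definition connected_graph (T : finType) (e : rel T) : Prop :=
  0 < #|T| /\ forall x y : T, connect e x y.

Definition bipartite (T : finType) (e : rel T) : Prop :=
  exists A : {set T}, forall x y : T, e x y -> (x \in A) != (y \in A).

(* The walk v_0 e_1 v_1 ... e_l v_l is given by v0 and p = [:: v_1; ...; v_l];
   the edges e_i = {v_(i-1), v_i} are determined by the vertices. *)
Definition closed_walk (T : finType) (e : rel T) (v0 : T) (p : seq T) : Prop :=
  path e v0 p /\ last v0 p = v0.

Definition walk_edges (T : finType) (v0 : T) (p : seq T) : seq {set T} :=
  pairmap (fun x y => [set x; y]) v0 p.

(* The start v_0 is not counted: the index runs over 1, ..., l. *)
Definition visit_number (T : finType) (p : seq T) (v : T) : nat :=
  count_mem v p.

Definition PHC (T : finType) (e : rel T) (v0 : T) (p : seq T) : Prop :=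
  closed_walk e v0 p /\ forall v : T, odd (visit_number p v).

Definition PHC_le (T : finType) (e : rel T) (z : nat) (v0 : T) (p : seq T)
    : Prop :=
  PHC e v0 p /\
  forall x y : T, e x y -> count_mem [set x; y] (walk_edges v0 p) <= z.

(* Main.v *)
Require Import Defs.
From mathcomp Require Import all_boot.
From mathcomp Require Import zify.

Set Implicit Arguments.
Unset Strict Implicit.
Unset Printing Implicit Defensive.

(** In a bipartite graph a closed walk meets both sides equally often, so its
    length, which has the parity of |V| for a PHC, is even.

    Conversely, order V as r, ..., v_2, v_1 so that every vertex but the root r
    has a neighbour closer to r in the list.  Start from a closed walk whose
    length has the parity of |V| and which uses each edge at most twice: the
    trivial walk if |V| is even, an odd cycle if |V| is odd and G is
    non-bipartite.  Detours v u v to unvisited vertices u make it spanning,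
    still using each edge at most twice.  Then, for v = v_1, v_2, ..., if v has
    even visit number, insert one detour v u v to a neighbour u closer to r.
    These detours use pairwise distinct edges, so no edge is used more than four
    times; at the end only r may have even visit number, and it does not because
    the length of the walk has the parity of |V|. *)

Lemma size_sum_count (T : finType) (p : seq T) :
  size p = \sum_(x : T) count_mem x p.
Proof.
elim: p => [|y p IH] /=; first by rewrite big1.
rewrite big_split /= -IH (bigD1 y) //= eqxx big1 // => x /negbTE.
by rewrite eq_sym => ->.
Qed.

(** The visit numbers add up to the length, and modulo 2 every vertex other than [r] cancels against
    its 1 in the sum for [#|T|]. Used for the length of a PHC and, at the end, for the root. *)
Lemma odd_size_visits (T : finType) (p : seq T) (r : T) :
  (forall x, x != r -> odd (visit_number p x)) ->
  odd (size p) (+) odd #|T| = ~~ odd (visit_number p r).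
Proof.
move=> h; rewrite size_sum_count -sum1_card (bigD1 r) //=.
rewrite [\sum_(x in T) 1](bigD1 r) //= !oddD -/(visit_number p r).
have -> : odd (\sum_(x | x != r) count_mem x p) = odd (\sum_(x | x != r) 1).
  apply: (big_ind2 (fun a b : nat => odd a = odd b)) => //.
  by move=> a b c d hab hcd; rewrite !oddD hab hcd.
by case: (odd (visit_number p r)); case: (odd (\sum_(_ | _) _)).
Qed.

(** Each step changes sides. The membership terms account for [p] omitting the start [x], and they
    cancel on a closed walk. *)
Lemma bipartite_walk_count (T : finType) (e : rel T) (A : {set T}) :
    (forall x y, e x y -> (x \in A) != (y \in A)) ->
  forall p x, path e x p ->
  count (mem A) p + (x \in A) = count (predC (mem A)) p + (last x p \in A).
Proof.
move=> hA; elim=> [|y p IH] x //= /andP[/hA exy /IH].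
by move: exy; case: (x \in A); case: (y \in A) => //= _; lia.
Qed.

Lemma bipartite_closed_walk_even (T : finType) (e : rel T) v0 p :
  bipartite e -> closed_walk e v0 p -> ~~ odd (size p).
Proof.
case=> A hA [hp hl]; have := bipartite_walk_count hA hp.
by rewrite hl -(count_predC (mem A) p) => /addIn ->; rewrite addnn odd_double.
Qed.

(** Asking for [v] in [v0 :: p] rather than in [p] allows a detour from the trivial walk. *)
Lemma closed_walk_detour (T : finType) (e : rel T) (v0 v u : T) (p : seq T) :
    symmetric e -> closed_walk e v0 p -> v \in v0 :: p -> e v u ->
  exists q, [/\ closed_walk e v0 q, perm_eq q [:: u, v & p] &
    forall E, count_mem E (walk_edges v0 q)
              = 2 * ([set v; u] == E) + count_mem E (walk_edges v0 p)].
Proof.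
move=> e_sym [hp hl] hv evu; case/splitPl: hv hp hl => p1 p2 l1 hp hl.
exists (p1 ++ [:: u, v & p2]); split.
- move: hp hl; rewrite /closed_walk !cat_path !last_cat /= l1.
  by case/andP=> -> -> ->; rewrite evu e_sym evu.
- exact: (permEl (perm_catCA p1 [:: u; v] p2)).
- move=> E; rewrite /walk_edges !pairmap_cat !count_cat /= l1 [[set u; v]]setUC.
  lia.
Qed.

(* Every element of s has a neighbour in what follows it, where the root r is
   regarded as placed after the end of s. *)
Fixpoint attached (T : finType) (e : rel T) (r : T) (s : seq T) : bool :=
  if s is v :: s' then has (e v) (r :: s') && attached e r s' else true.

Lemma attached_enum (T : finType) (e : rel T) (r : T) :
    symmetric e -> (forall x y, connect e x y) ->
  exists s, [/\ uniq (r :: s), attached e r s & forall x, x \in r :: s].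
Proof.
move=> e_sym e_conn.
(* Vertices with a neighbour in the list are prepended greedily. Here [k] counts the vertices
   outside [s], among them [r], so [k = 0] is impossible. *)
suff grow k s : k + size s = #|T| -> uniq (r :: s) -> attached e r s ->
    exists s, [/\ uniq (r :: s), attached e r s & forall x, x \in r :: s].
  by apply: (grow #|T| [::]); rewrite ?addn0.
elim: k s => [|k IH] s hk us ats.
  have := max_card (mem (r :: s)); rewrite (card_uniqP us) /=.
  by rewrite -hk add0n ltnn.
have [/existsP[v /andP[vs hv]]|/existsPn h] :=
  boolP [exists v, (v \notin r :: s) && has (e v) (r :: s)].
  apply: (IH (v :: s)); first by rewrite /= -hk addSnnS.
    move: us vs; rewrite /= !inE !negb_or eq_sym => /andP[-> ->].
    by case/andP=> -> ->.
  by apply/andP; split.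
exists s; split=> // x.
(* No vertex can be added, so the list is closed under [e] and connectivity makes it everything. *)
have cl : closed e (mem (r :: s)).
  apply: (intro_closed (sym_connect_sym e_sym)) => a b eab /= ha.
  apply: contraT => hb; have := h b; rewrite hb andTb => /hasPn/(_ a ha).
  by rewrite e_sym eab.
by rewrite -(closed_connect cl (e_conn r x)) inE eqxx.
Qed.

Lemma notin_walk_edges (T : finType) (v0 v : T) (p : seq T) (E : {set T}) :
  v \notin v0 :: p -> v \in E -> count_mem E (walk_edges v0 p) = 0.
Proof.
move=> + vE; elim: p v0 => [|y p IH] x //=.
rewrite inE negb_or => /andP[vx hv].
rewrite (IH y hv) addn0; case: eqP => // hE; move: vE.
by rewrite -hE !inE (negbTE vx); case/norP: hv => /negbTE ->.
Qed.

(** The induction starts from the end of [s], so the neighbour [u] of [v] is already visited. If [v]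
    is not, no edge at [v] has been used, and the detour takes the count of [{u, v}] from 0 to 2. *)
Lemma closed_walk_spanning (T : finType) (e : rel T) (v0 : T) (p s : seq T) :
    symmetric e -> closed_walk e v0 p -> attached e v0 s ->
    (forall E, count_mem E (walk_edges v0 p) <= 2) ->
  exists q, [/\ closed_walk e v0 q, odd (size q) = odd (size p),
    {subset s <= v0 :: q} & forall E, count_mem E (walk_edges v0 q) <= 2].
Proof.
move=> e_sym cp + cnt; elim: s => [|v s IH] /=; first by exists p.
case/andP=> hv /IH[q [cq oq sq cntq]].
have [vq|vq] := boolP (v \in v0 :: q).
  by exists q; split=> // x; rewrite inE => /orP[/eqP->|/sq].
have [u us evu] := hasP (hv : has (e v) (v0 :: s)).
have uq : u \in v0 :: q.
  by move: us; rewrite inE => /orP[/eqP->|/sq //]; rewrite inE eqxx.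
rewrite e_sym in evu.
have [q' [cq' pq' cntq']] := closed_walk_detour e_sym cq uq evu.
exists q'; split=> //.
- by rewrite (perm_size pq') /= negbK.
- move=> x; rewrite !in_cons (perm_mem pq') !inE.
  by case/orP=> [->|/sq]; rewrite ?orbT // inE => /orP[->|->]; rewrite ?orbT.
- move=> E; rewrite cntq'; case: eqP => [<-|_]; last exact: cntq.
  by rewrite (notin_walk_edges vq) // !inE eqxx orbT.
Qed.

(** The last two conclusions drive the induction: later detours stay inside the remaining list, so
    they neither change the visit number of a treated vertex nor reuse its edge. *)
Lemma closed_walk_fix_parity (T : finType) (e : rel T) r v0 (s p : seq T) :
    symmetric e -> uniq (r :: s) -> attached e r s ->
    closed_walk e v0 p -> (forall x, x \in v0 :: p) ->
  exists q, [/\ closed_walk e v0 q, odd (size q) = odd (size p),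
    forall x, x \in s -> odd (visit_number q x),
    forall x, x \notin r :: s -> visit_number q x = visit_number p x &
    forall x y, count_mem [set x; y] (walk_edges v0 q)
      <= 2 * ((x \in r :: s) && (y \in r :: s))
         + count_mem [set x; y] (walk_edges v0 p)].
Proof.
move=> e_sym; elim: s p => [|v s IH] p us ats cp ap.
  by exists p; split=> // x y; apply: leq_addl.
have /andP[hv {}ats] := ats : has (e v) (r :: s) && attached e r s.
have [vrs {}us] : v \notin r :: s /\ uniq (r :: s).
  move: us; rewrite /= !inE !negb_or [v == r]eq_sym.
  by case/andP=> /andP[-> ->] /andP[-> ->].
have sub x : x \in r :: s -> x \in r :: v :: s.
  by rewrite !inE => /orP[->|->]; rewrite ?orbT.
suff [p1 [cp1 op1 ap1 [pv pn] le1]] : exists p1,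
   [/\ closed_walk e v0 p1, odd (size p1) = odd (size p),
    (forall x, x \in v0 :: p1), odd (visit_number p1 v) /\
     forall x, x \notin r :: v :: s -> visit_number p1 x = visit_number p x &
    forall x y, count_mem [set x; y] (walk_edges v0 p1)
      <= 2 * [&& x \in r :: v :: s, y \in r :: v :: s
               & (x == v) || (y == v)]
         + count_mem [set x; y] (walk_edges v0 p)].
  have [q [cq oq qs qn leq]] := IH p1 us ats cp1 ap1.
  exists q; split=> //.
  - by rewrite oq.
  - by move=> x; rewrite inE => /orP[/eqP->|/qs //]; rewrite qn.
  - by move=> x hx; rewrite qn ?pn //; apply: contra hx; apply: sub.
  - move=> x y; apply: leq_trans (leq x y) _.
    apply: leq_trans (leq_add (leqnn _) (le1 x y)) _.
    rewrite addnA leq_add2r -mulnDr leq_mul2l /=.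
    (* An edge inside [r :: s] avoids [v], so at most one of the two increments is nonzero. *)
    have [/andP[hx hy]|_] := boolP ((x \in r :: s) && (y \in r :: s)).
      rewrite !sub //=.
      have /negbTE-> : x != v by apply: contraNneq vrs => <-.
      by have /negbTE-> : y != v by apply: contraNneq vrs => <-.
    by case: (x \in _); case: (y \in _); case: (_ || _).
have [ov|ov] := boolP (odd (visit_number p v)).
  by exists p; split=> // x y; apply: leq_addl.
have [u us' evu] := hasP hv.
have uv : u != v by apply: contraNneq vrs => <-.
have [q [cq pq cntq]] := closed_walk_detour e_sym cp (ap v) evu.
exists q; split=> //.
- by rewrite (perm_size pq) /= negbK.
- move=> x; move: (ap x); rewrite !in_cons (perm_mem pq) !inE.
  by case/orP=> [->|->]; rewrite ?orbT.
- rewrite {1}/visit_number (permP pq) /= (negbTE uv) eqxx add0n add1n /=.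
  split; first exact: ov.
  move=> x hx; rewrite /visit_number (permP pq) /=.
  have /negbTE-> : u != x by apply: contraNneq hx => <-; apply: sub.
  have /negbTE-> // : v != x.
  by apply: contraNneq hx => <-; rewrite !inE eqxx orbT.
- move=> x y; rewrite cntq leq_add2r.
  case: eqP => [/setP hE|_]; last by rewrite muln0.
  have in2 z : z \in [set v; u] -> z \in r :: v :: s.
    by rewrite in_set2 => /orP[]/eqP->; [rewrite !inE eqxx orbT|apply: sub].
  have hx : x \in r :: v :: s by apply: in2; rewrite hE !inE eqxx.
  have hy : y \in r :: v :: s by apply: in2; rewrite hE !inE eqxx orbT.
  have := hE v; rewrite !in_set2 eqxx /= => /esym hv'.
  by rewrite hx hy [x == v]eq_sym [y == v]eq_sym hv'.
Qed.

Lemma uniq_walk_edges_le2 (T : finType) (v0 : T) (p : seq T) (E : {set T}) :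
  uniq p -> count_mem E (walk_edges v0 p) <= 2.
Proof.
move=> up.
(* An occurrence of {x, y} ends at a visit of x or of y. *)
have bound (x y : T) q z :
    count_mem [set x; y] (walk_edges z q) <= count_mem x q + count_mem y q.
  elim: q z => [|w q IH] z //=.
  rewrite addnACA; apply: leq_add; last exact: IH.
  case: eqP => // hE; have : w \in [set x; y] by rewrite -hE !inE eqxx orbT.
  by rewrite in_set2; case: (w == x); case: (w == y).
have [/hasP[F hF /eqP<-]|/negbTE] := boolP (has (pred1 E) (walk_edges v0 p));
  last first.
  by rewrite has_count lt0n => /negbFE/eqP->.
have [i hi <-] := nthP set0 hF.
rewrite size_pairmap in hi; rewrite (nth_pairmap v0) //=.
by apply: leq_trans (bound _ _ _ _) _; rewrite !count_uniq_mem //; lia.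
Qed.

(** A repeated vertex splits the walk into a loop and the rest, both closed and shorter. Their
    lengths have an odd sum, so one of them is odd. *)
Lemma odd_closed_walk_uniq (T : finType) (e : rel T) (v0 : T) (p : seq T) :
    closed_walk e v0 p -> odd (size p) ->
  exists v q, [/\ closed_walk e v q, odd (size q) & uniq q].
Proof.
have [n] := ubnP (size p); elim: n v0 p => // n IH v0 p hn cp op.
have [up|] := boolP (uniq p); first by exists v0, p.
move=> nup.
have [v [p1 [p2 [p3 ep]]]] : exists v p1 p2 p3, p = p1 ++ v :: p2 ++ v :: p3.
  elim: (p) nup => //= x q IHq; rewrite negb_and negbK.
  case/orP=> [/splitPr[q1 q2]|/IHq[v [p1 [p2 [p3 ->]]]]].
    by exists x, [::], q1, q2.
  by exists v, (x :: p1), p2, p3.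
move: cp hn op; rewrite ep => -[].
rewrite !(cat_path, last_cat) /= !(cat_path, last_cat) /=.
case/and5P=> h1 ev h2 ev2 h3 hl.
rewrite !size_cat /= size_cat /= => hn.
have [o2 _|o2 op] := boolP (odd (size p2).+1).
  apply: (IH v (rcons p2 v)); rewrite ?size_rcons //; first by lia.
  by rewrite /closed_walk rcons_path last_rcons h2.
apply: (IH v0 (p1 ++ v :: p3)); rewrite ?size_cat /=; first by lia.
  by rewrite /closed_walk cat_path last_cat /= h1 ev h3.
by move: op o2; rewrite !oddD /= !oddD /=;
  case: (odd (size p1)); case: (odd (size p2)); case: (odd (size p3)).
Qed.

(** Colour [x] by the parity of a chosen walk [f x] from [r]. Some edge [xy] joins equal colours,
    and [f x], this edge and [f y] reversed form an odd closed walk. *)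
Lemma nonbipartite_odd_closed_walk (T : finType) (e : rel T) (r : T) :
    symmetric e -> (forall x, connect e r x) -> ~ bipartite e ->
  exists p, closed_walk e r p /\ odd (size p).
Proof.
move=> e_sym e_conn nb.
have walk x : exists p, path e r p && (last r p == x).
  by have /connectP[p hp ->] := e_conn x; exists p; rewrite hp eqxx.
pose f x := xchoose (walk x).
have fP x : path e r (f x) /\ last r (f x) = x.
  by have /andP[? /eqP] := xchooseP (walk x).
pose A := [set x | odd (size (f x))].
have [/forallP h|] :=
    boolP [forall x, forall y, e x y ==> ((x \in A) != (y \in A))].
  by case: nb; exists A => x y exy; move/forallP/(_ y)/implyP: (h x); apply.
case/forallPn=> x /forallPn[y]; rewrite negb_imply negbK !inE.
case/andP=> exy /eqP par.
have [px lx] := fP x; have [py ly] := fP y.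
exists (f x ++ y :: rev (belast r (f y))); split; last first.
  by rewrite size_cat /= size_rev size_belast oddD /= par; case: odd.
rewrite /closed_walk cat_path last_cat px lx /= exy -{1}ly rev_path.
split; first by rewrite (eq_path (e' := e)) // => a b; apply: e_sym.
(* If [f y] is empty, then [y = r] and the walk already ends at [r]. *)
move: ly; case: (f y) => [|z q] /=; first by move->.
by rewrite rev_cons last_rcons.
Qed.

Theorem theorem3p2 (T : finType) (e : rel T)
    (e_sym : symmetric e) (e_irr : irreflexive e)
    (e_conn : connected_graph e) :
  (exists (v0 : T) (p : seq T), PHC_le e 4 v0 p) <->
  (~~ odd #|T| \/ ~ bipartite e).
Proof.
have [/card_gt0P[r _] conn] := e_conn; split.
  case=> v0 [p [[cp op] _]]; case: (boolP (odd #|T|)) => oT; [right|by left].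
  move=> /bipartite_closed_walk_even/(_ cp).
  have := @odd_size_visits T p r (fun x _ => op x).
  by rewrite oT op; case: odd.
move=> h.
have [v0 [p [cp op cnt]]] : exists v0 p, [/\ closed_walk e v0 p,
    odd (size p) = odd #|T| & forall E, count_mem E (walk_edges v0 p) <= 2].
  have [oT|_] := boolP (odd #|T|); last by exists r, [::].
  case: h => [|nb]; first by rewrite oT.
  have [p [cp op]] := @nonbipartite_odd_closed_walk T e r e_sym (conn r) nb.
  have [v [q [cq oq uq]]] := odd_closed_walk_uniq cp op.
  by exists v, q; split=> // E; apply: uniq_walk_edges_le2.
(* The root is the start [v0] of the walk, possibly different from [r]; it counts as visited even
   when the walk is trivial. *)
have [s [us ats alls]] := attached_enum v0 e_sym conn.
have [q [cq oq sq cntq]] := closed_walk_spanning e_sym cp ats cnt.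
have allq x : x \in v0 :: q.
  by move: (alls x); rewrite inE => /orP[/eqP->|/sq //]; rewrite inE eqxx.
have [w [cw ow ws _ cntw]] := closed_walk_fix_parity e_sym us ats cq allq.
have ws' x : x != v0 -> odd (visit_number w x).
  by move=> xv; apply: ws; move: (alls x); rewrite inE (negbTE xv).
exists v0, w; split; first split=> // v.
  have [->|/ws' //] := eqVneq v v0.
  by have := odd_size_visits ws'; rewrite ow oq op addbb => /esym/negbFE.
(* Two uses from the spanning walk and two from the parity detours. *)
move=> x y _; apply: leq_trans (cntw x y) _; have := cntq [set x; y].
by rewrite !alls /=; lia.
Qed.
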